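(* If $M$ is a cographic matroid (not necessarily simple), then $\tau(M) \le 2\nu(M)$.
   Context: All graphs and matroids are finite; graphs may have loops and parallel edges. A matroid is cographic if its dual is graphic, i.e. if it is isomorphic to $M^*(G)$, the dual of the cycle matroid $M(G)$ of some graph $G$. The ground set of $M^*(G)$ is $E(G)$, and its circuits are the minimal edge cuts (bonds) of $G$. Matroids need not be simple: loops and parallel elements are allowed, and parallel elements count as distinct elements. A triangle of a matroid $M$ is a circuit of $M$ with exactly 3 elements (so the triangles of $M^*(G)$ are the bonds of $G$ of cardinality 3). A triangle packing of $M$ is a collection of pairwise disjoint triangles of $M$. A triangle hitting set of $M$ is a set $X \subseteq E(M)$ that meets every triangle of $M$. $\nu(M)$ denotes the maximum size of a triangle packing of $M$, and $\tau(M)$ denotes the minimum size of a triangle hitting set of $M$. *)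

(* Defs.v *)
From mathcomp Require Import all_boot.
Set Implicit Arguments.
Unset Strict Implicit.
Unset Printing Implicit Defensive.

(* A matroid on the ground set [E] (the whole finite type), by independent
   sets. *)
Record matroid (E : finType) := Matroid {
  indep :> {set E} -> bool;
  indep0 : indep set0;
  indepS : forall A B : {set E}, A \subset B -> indep B -> indep A;
  indep_aug : forall A B : {set E}, indep A -> indep B -> #|A| < #|B| ->
    exists2 e, e \in B :\: A & indep (e |: A)
}.

Section MatroidTheory.

Variables (E : finType) (M : matroid E).

Definition circuit (C : {set E}) : bool := minset (fun X => ~~ indep M X) C.

Definition basis (B : {set E}) : bool := maxset (indep M) B.

Lemma indep_card_basis (A B : {set E}) : indep M A -> basis B -> #|A| <= #|B|.
Proof.
move=> iA /maxsetP[iB maxB]; rewrite leqNgt; apply/negP => ltBA.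
have [e /setDP[_ eNB] ieB] := indep_aug iB iA ltBA.
by move: eNB; rewrite -(maxB _ ieB (subsetUr _ _)) setU11.
Qed.

Lemma basis_card (A B : {set E}) : basis A -> basis B -> #|A| = #|B|.
Proof.
move=> bA bB; have [iA _] := maxsetP bA; have [iB _] := maxsetP bB.
by apply/eqP; rewrite eqn_leq !indep_card_basis.
Qed.

Lemma card_basis (A B : {set E}) :
  indep M A -> basis B -> #|B| <= #|A| -> basis A.
Proof.
move=> iA bB leBA; apply/maxsetP; split=> // C iC sAC.
apply/esym/eqP; rewrite eqEcard sAC /=.
exact: leq_trans (indep_card_basis iC bB) leBA.
Qed.

Lemma basis_extend (A B : {set E}) : indep M A -> basis B ->
  exists C : {set E}, [/\ basis C, A \subset C & C \subset A :|: B].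
Proof.
move=> iA bB; have [k] := ubnP (#|B| - #|A|); elim: k A iA => // k IHk A iA.
have [leBA _ | ltAB ltk] := leqP #|B| #|A|.
  by exists A; rewrite subxx subsetUl (card_basis iA bB).
have [iB _] := maxsetP bB.
have [e /setDP[eB eNA] ieA] := indep_aug iA iB ltAB.
have [|C [bC sC sCA]] := IHk _ ieA.
  by rewrite cardsU1 eNA add1n subnS prednK ?subn_gt0.
exists C; split=> //; first exact: subset_trans (subsetUr _ _) sC.
apply: subset_trans sCA _; apply/subsetP=> x; rewrite !inE.
by case/orP=> [/orP[/eqP->|->]|->]; rewrite ?eB ?orbT.
Qed.

Lemma basis_exists : exists B : {set E}, basis B.
Proof. by have [B bB _] := maxset_exists (indep0 M); exists B. Qed.

Definition coindep (X : {set E}) : bool :=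
  [exists B : {set E}, basis B && [disjoint X & B]].

Lemma coindep0 : coindep set0.
Proof.
have [B bB] := basis_exists; apply/existsP; exists B.
by rewrite bB -setI_eq0 set0I eqxx.
Qed.

Lemma coindepS (X Y : {set E}) : X \subset Y -> coindep Y -> coindep X.
Proof.
move=> sXY /existsP[B /andP[bB dYB]]; apply/existsP; exists B.
by rewrite bB (disjointWl sXY dYB).
Qed.

Lemma coindep_aug (X Y : {set E}) : coindep X -> coindep Y -> #|X| < #|Y| ->
  exists2 e, e \in Y :\: X & coindep (e |: X).
Proof.
case/existsP=> BX /andP[bBX dX] /existsP[B /andP[bB dY]] ltXY.
have [iB _] := maxsetP bB.
have [C [bC sC sCU]] := basis_extend (indepS (subsetDl B X) iB) bBX.
have dXC : [disjoint X & C].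
  rewrite -setI_eq0 -subset0; apply/subsetP=> x /setIP[xX /(subsetP sCU)].
  by rewrite !inE xX /= => xBX; move: (disjointFr dX xX); rewrite xBX.
have [sYC | /subsetPn[e eYX eNC]] := boolP (Y :\: X \subset C); last first.
  exists e => //; apply/existsP; exists C; rewrite bC /=.
  by rewrite -setI_eq0 setIUl setU_eq0 !setI_eq0 disjoints1 eNC.
have sDU : (B :\: X) :|: (Y :\: X) \subset C by rewrite subUset sC.
have dD : (B :\: X) :&: (Y :\: X) = set0.
  apply/eqP; rewrite setI_eq0 disjoint_sym.
  exact: disjointWl (subsetDl _ _) (disjointWr (subsetDl _ _) dY).
have := subset_leq_card sDU; rewrite cardsU dD cards0 subn0 (basis_card bC bB).
have dYB : Y :&: B = set0 by apply/eqP; rewrite setI_eq0.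
have leXB : #|B :&: X| <= #|X :\: Y|.
  apply/subset_leq_card/subsetP=> x /setIP[xB xX]; rewrite inE xX andbT.
  by apply/negP=> xY; move/setP/(_ x): dYB; rewrite !inE xY xB.
rewrite -(cardsID X B) [in X in X <= _]addnC leq_add2r => leYX.
have leYX' := leq_trans leYX leXB.
move: ltXY; rewrite -(cardsID Y X) -(cardsID X Y) (setIC Y X) ltn_add2l.
by rewrite ltnNge leYX'.
Qed.

Definition dual : matroid E := Matroid coindep0 coindepS coindep_aug.

Definition triangle (T : {set E}) : bool := circuit T && (#|T| == 3).

Definition triangle_packing (P : {set {set E}}) : bool :=
  [forall T in P, triangle T] && trivIset P.

Definition triangle_hitting_set (X : {set E}) : bool :=
  [forall T : {set E}, triangle T ==> ~~ [disjoint X & T]].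

Definition nu : nat := \max_(P : {set {set E}} | triangle_packing P) #|P|.

(* [setT] is only the default witness: it is always a hitting set, see
   [triangle_hitting_setT]. *)
Definition tau : nat :=
  #|[arg min_(X < [set: E] | triangle_hitting_set X) #|X|]|.

Lemma triangle_hitting_setT : triangle_hitting_set [set: E].
Proof.
apply/forallP=> T; apply/implyP=> /andP[_ /eqP T3].
by rewrite -setI_eq0 setTI -cards_eq0 T3.
Qed.

End MatroidTheory.

Definition matroid_iso (E F : finType) (M : matroid E) (N : matroid F) : Prop :=
  exists2 f : E -> F, bijective f & forall X : {set E}, M X = N (f @: X).

(* An undirected multigraph. The pair of ends of an edge is recorded in an
   arbitrary order, which plays no role; equal ends make a loop. *)
Record multigraph := Multigraph {
  vertex : finType;
  edge : finType;
  ends : edge -> vertex * vertex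
}.

Section CycleMatroid.

Variable G : multigraph.
Implicit Types (F I J : {set edge G}).

(* An edge together with a direction in which to traverse it. *)
Definition dart : finType := (edge G * bool)%type.
Definition src (d : dart) : vertex G :=
  if d.2 then (ends d.1).1 else (ends d.1).2.
Definition tgt (d : dart) : vertex G :=
  if d.2 then (ends d.1).2 else (ends d.1).1.

(* A closed walk of positive length with no repeated vertex and no repeated
   edge. *)
Definition cyclic_walk (s : seq dart) : bool :=
  [&& s != [::], cycle (fun d d' => tgt d == src d') s,
      uniq (map src s) & uniq (map fst s)].

Definition cycle_edges (C : {set edge G}) : bool :=
  [exists s : #|C|.-tuple dart, cyclic_walk s && (C == [set d.1 | d in s])].

Definition forest F : bool :=
  ~~ [exists C : {set edge G}, cycle_edges C && (C \subset F)].

Lemma cycle_edgesP (C : {set edge G}) :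
  reflect (exists2 s : seq dart, cyclic_walk s & C =i map fst s) (cycle_edges C).
Proof.
apply: (iffP existsP) => [[s /andP[cs /eqP defC]] | [s cs defC]].
  exists s => // e; have/setP/(_ e)-> := defC.
  by apply/imsetP/mapP; case=> d ds ->; exists d.
have szs : size s == #|C|.
  by case/and4P: cs => _ _ _ /card_uniqP; rewrite size_map (eq_card defC) => ->.
exists (Tuple szs); rewrite cs /=; apply/eqP/setP=> e; rewrite defC.
by apply/mapP/imsetP; case=> d ds ->; exists d.
Qed.

Lemma forestPn F :
  reflect (exists2 s, cyclic_walk s & {subset map fst s <= F}) (~~ forest F).
Proof.
rewrite negbK; apply: (iffP existsP) => [[C /andP[/cycle_edgesP[s cs dC] sCF]]|].
  by exists s => // e; rewrite -dC; apply: (subsetP sCF).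
case=> s cs sF; exists [set e in map fst s]; apply/andP; split.
  by apply/cycle_edgesP; exists s => // e; rewrite inE.
by apply/subsetP=> e; rewrite inE; apply: sF.
Qed.

Definition dart_rev (d : dart) : dart := (d.1, ~~ d.2).

Lemma src_rev d : src (dart_rev d) = tgt d. Proof. by case: d => e []. Qed.
Lemma tgt_rev d : tgt (dart_rev d) = src d. Proof. by case: d => e []. Qed.

Definition adjacent F : rel (vertex G) :=
  [rel x y | [exists d : dart, [&& d.1 \in F, src d == x & tgt d == y]]].

Lemma adjacent_sym F : symmetric (adjacent F).
Proof.
suff adjC x y : adjacent F x y -> adjacent F y x.
  by move=> x y; apply/idP/idP; apply: adjC.
case/existsP=> d /and3P[dF sx ty]; apply/existsP; exists (dart_rev d).
by rewrite src_rev tgt_rev dF sx ty.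
Qed.

Lemma linked_sym F x y : connect (adjacent F) x y = connect (adjacent F) y x.
Proof. by apply: sym_connect_sym; apply: adjacent_sym. Qed.

Definition linked F (d : dart) := connect (adjacent F) (src d) (tgt d).

Lemma linked_in F d : d.1 \in F -> linked F d.
Proof. by move=> dF; apply/connect1/existsP; exists d; rewrite dF !eqxx. Qed.

Lemma linked_sub F I :
  (forall d, d.1 \in F -> linked I d) ->
  subrel (connect (adjacent F)) (connect (adjacent I)).
Proof.
move=> FI; apply: connect_sub => x y /existsP[d /and3P[dF /eqP<- /eqP<-]].
exact: FI.
Qed.

Lemma linked_edge F d d' : d'.1 = d.1 -> linked F d' = linked F d.
Proof.
case: d d' => [e b] [e' b'] /= ->.
by rewrite /linked; case: b b' => [] [] //=; apply: linked_sym.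
Qed.

Lemma walk_connect F d d' s :
    path (fun d d' => tgt d == src d') d (rcons s d') ->
    {subset map fst s <= F} ->
  connect (adjacent F) (tgt d) (src d').
Proof.
elim: s d => [|d1 s IHs] d /= => [/andP[/eqP-> _] _ | /andP[/eqP-> ds] sF].
  exact: connect0.
apply: connect_trans (IHs _ ds _); first exact: linked_in (sF _ (mem_head _ _)).
by move=> e es; apply: sF; rewrite inE es orbT.
Qed.

Lemma path_walk F x p : path (adjacent F) x p -> uniq (x :: p) ->
  exists s : seq dart, [/\ {subset map fst s <= F}, map src s = belast x p,
    map tgt s = p, uniq (map fst s) &
    forall d, tgt d = x -> path (fun d d' => tgt d == src d') d s].
Proof.
elim: p x => [|y p IHp] x /=; first by exists [::].
case/andP=> /existsP[d /and3P[dF /eqP sd /eqP td]] yp /andP[xNyp Uyp].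
have [s [sF ss ts Us ws]] := IHp y yp Uyp.
exists (d :: s); split=> /=.
- by move=> e; rewrite inE => /predU1P[->|/sF].
- by rewrite sd ss.
- by rewrite td ts.
- rewrite Us andbT; apply: contra xNyp => /mapP[d' d's ed'].
  have [src_d' | tgt_d']: src d' = x \/ tgt d' = x.
    rewrite -sd; case: (d) (d') ed' => [e b] [e' b'] /= ->.
    by rewrite /src /tgt; case: b b' => [] []; [left | right | right | left].
  + rewrite lastI mem_rcons inE -ss; apply/orP; right.
    by rewrite -src_d' map_f.
  + by rewrite inE -ts -tgt_d' map_f ?orbT.
- by move=> d0 ->; rewrite sd eqxx ws.
Qed.

Lemma forestU1 F d : forest F -> ~~ linked F d -> forest (d.1 |: F).
Proof.
move=> fF; apply: contraR => /forestPn[s cs sF].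
have [/mapP[d' /rot_to[i t def_t] ed'] | dNs] := boolP (d.1 \in map fst s).
  have tE e : (e \in map fst (d' :: t)) = (e \in map fst s).
    by rewrite -def_t map_rot mem_rot.
  case/and4P: cs => _; rewrite -(rot_cycle i) def_t => /= ct _.
  rewrite -(rot_uniq i) -map_rot def_t /= => /andP[dNt _].
  rewrite (linked_edge F ed') /linked linked_sym.
  apply: walk_connect ct _ => e et.
  have: e \in d.1 |: F by apply: sF; rewrite -tE inE et orbT.
  by case/setU1P=> // e_d; rewrite -ed' -e_d et in dNt.
suff: ~~ forest F by rewrite fF.
apply/forestPn.
exists s => // e es; have /setU1P[e_d|//] := sF e es.
by rewrite -e_d es in dNs.
Qed.

Lemma forestD1 F d : forest F -> d.1 \in F -> ~~ linked (F :\ d.1) d.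
Proof.
move=> fF dF; apply/negP=> /connectP[p0 xp0 tgt_d].
have: last (src d) p0 = tgt d by [].
case/shortenP: xp0 => p xp Up _ {p0 tgt_d} tgt_d.
have [s [sF ss ts Us ws]] := path_walk xp Up.
suff: ~~ forest F by rewrite fF.
apply/forestPn.
exists (dart_rev d :: s).
  apply/and4P; split=> //=.
  - by rewrite rcons_path ws ?tgt_rev //= src_rev -last_map ts tgt_rev tgt_d.
  - by move: Up; rewrite lastI rcons_uniq tgt_d ss src_rev.
  - by rewrite Us andbT; apply/negP=> /sF; rewrite !inE eqxx.
by move=> e; rewrite inE => /predU1P[->//|/sF/setD1P[]].
Qed.

Lemma forest0 : forest set0.
Proof.
apply: contraT => /forestPn[[|d s] // _ sF].
by have := sF _ (mem_head _ _); rewrite inE.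
Qed.

Lemma forestS F I : F \subset I -> forest I -> forest F.
Proof.
move=> sFI; apply: contraLR => /forestPn[s cs sF]; apply/forestPn.
by exists s => // e /sF; apply: (subsetP sFI).
Qed.

Lemma linked_forest_leq I J :
  forest J -> (forall d, d.1 \in J -> linked I d) -> #|J| <= #|I|.
Proof.
have [k] := ubnP #|J :\: I|; elim: k J => // k IHk J leJk fJ JI.
have [sJI | /subsetPn[e eJ eNI]] := boolP (J \subset I).
  exact: subset_leq_card.
pose d : dart := (e, true); have Ned := forestD1 (d := d) fJ eJ.
have [/forallP If | ] := boolP [forall f : dart, (f.1 \in I) ==> linked (J :\ e) f].
  case/negP: Ned; apply: (linked_sub _ (JI d eJ)) => f fI.
  exact: (implyP (If f)).
case/forallPn=> f; rewrite negb_imply => /andP[fI Nf].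
have fNJe : f.1 \notin J :\ e by apply: contra Nf => /linked_in.
have -> : #|J| = #|f.1 |: J :\ e| by rewrite cardsU1 fNJe (cardsD1 e J) eJ.
apply: IHk.
- rewrite ltnS in leJk; apply: leq_trans leJk.
  rewrite [X in _ < X](cardsD1 e) inE eJ eNI ltnS; apply/subset_leq_card/subsetP=> g.
  rewrite !inE => /andP[gNI]; case/orP=> [/eqP g_f | /andP[-> ->]].
    by rewrite g_f fI in gNI.
  by rewrite gNI.
- exact: forestU1 (forestS (subsetDl _ _) fJ) Nf.
- move=> g; rewrite !inE => /orP[/eqP g_f | /andP[_ gJ]]; last exact: JI.
  by apply: linked_in; rewrite g_f.
Qed.

Lemma forest_aug I J : forest I -> forest J -> #|I| < #|J| ->
  exists2 e, e \in J :\: I & forest (e |: I).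
Proof.
move=> fI fJ ltIJ.
have [/forallP JI | ] := boolP [forall d : dart, (d.1 \in J) ==> linked I d].
  have: #|J| <= #|I| by apply: linked_forest_leq => // d; apply/implyP.
  by rewrite leqNgt ltIJ.
case/forallPn=> d; rewrite negb_imply => /andP[dJ Nd].
exists d.1; last exact: forestU1.
by rewrite inE dJ andbT; apply: contra Nd => /linked_in.
Qed.

Definition cycle_matroid : matroid (edge G) := Matroid forest0 forestS forest_aug.

End CycleMatroid.

Definition graphic (E : finType) (M : matroid E) : Prop :=
  exists G : multigraph, matroid_iso M (cycle_matroid G).

Definition cographic (E : finType) (M : matroid E) : Prop := graphic (dual M).

(* Main.v *)
Require Import Defs.
From mathcomp Require Import all_boot.

(* The circuits of M are the bonds of G. Identifying parallel elements turns the
   triangles into 3-edge cuts whose union contains no cut of size 1 or 2; by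
   parity such cuts do not cross, so they are the cuts of a laminar family of
   vertex sets. Induct on the number of remaining elements: deleting a triangle
   [T] and adding it to the packing works unless the cover F of the rest contains
   all of [T], so that its cost exceeds the bound by 1. Let X be a smallest
   non-minimal set of the family, or V(G) if there is none. The members
   below X are disjoint, and some element [e] outside the cut of X lies in one or
   two of their triangles. If [e] lies only in
   [v], then F minus [e] is a better cover. If [e] lies in [v] and [v'], take bad
   covers F1 of the rest of [v] and F2 of the rest of [v']: after one copy of
   [e] is dropped from F1 + F2, the remaining elements can be redistributed into
   two covers, one of which meets the bound. The redistribution follows
   alternating paths with 4 possible starting points, the elements of [v] and [v']
   other than [e], while only the 3 elements of the cut of X could block them. *)

Set Implicit Arguments.
Unset Strict Implicit.
Unset Printing Implicit Defensive.

(** * Exchanging two covers *)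

Section DegreeTwo.

Variables (K : finType) (r : rel K).
Hypothesis r_sym : symmetric r.
Hypothesis r_deg2 : forall x, #|r x| <= 2.

(** The simple path from [x] to [y] is closed under [r]: its ends have used up their one neighbour
    and its inner vertices their two. So [z], if connected, would be an inner vertex, with two
    neighbours. *)
Lemma connected_ends_le2 x y z : x != y -> x != z -> y != z ->
  #|r x| <= 1 -> #|r y| <= 1 -> #|r z| <= 1 ->
  connect r x y -> ~~ connect r x z.
Proof.
move=> xy xz yz dx dy dz /connectP[p0 xp0 y_last].
case/shortenP: xp0 y_last => p xp Up _ y_last {p0}.
pose s := x :: p.
have nthS i : i < size p -> r (nth x s i) (nth x s i.+1) by move/(pathP x): xp; apply.
have nth_size : nth x s (size p) = y by rewrite y_last (last_nth x).
have nth_neq i j : i <= size p -> j <= size p -> i != j -> nth x s i != nth x s j.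
  by move=> ip jp; rewrite (nth_uniq x _ _ Up) ?ltnS.
have le1 u a b : #|r u| <= 1 -> r u a -> r u b -> a = b.
  by move=> du ua ub; apply: (card_le1_eqP du).
have inner i : 0 < i < size p ->
    [/\ r (nth x s i) (nth x s i.-1), r (nth x s i) (nth x s i.+1)
      & nth x s i.-1 != nth x s i.+1].
  case/andP=> i0 ip; rewrite r_sym -{2}(prednK i0) !nthS //;
    last exact: leq_ltn_trans (leq_pred i) ip.
  split=> //; apply: nth_neq => //; last by rewrite neq_ltn ltnS leq_pred.
  exact: leq_trans (leq_pred i) (ltnW ip).
have p_gt0 : 0 < size p by rewrite lt0n; apply: contra xy; rewrite y_last => /nilP->.
have s_closed u w : u \in s -> r u w -> w \in s.
  case/(nthP x)=> i; rewrite /= ltnS => ip <- uw.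
  have mem_s j : j <= size p -> nth x s j \in s by move=> jp; apply: mem_nth.
  have [i0|i0] := posnP i.
    by rewrite i0 /= in uw; rewrite (le1 x w _ dx uw (nthS 0 p_gt0)) mem_s.
  have [i_lt|i_ge] := ltnP i (size p).
    have [|ra rb ab] := inner i; first by rewrite i0.
    apply: contraT => ws; suff : 2 < #|r (nth x s i)| by rewrite ltnNge r_deg2.
    apply/card_gt2P; exists (nth x s i.-1), (nth x s i.+1), w.
    split; split=> //; apply: contraNneq ws; [move=> <- | move=> ->]; apply: mem_s => //.
    exact: leq_trans (leq_pred i) ip.
  have i_size : i = size p by apply: anti_leq; rewrite ip i_ge.
  rewrite i_size nth_size in uw.
  have yi : r y (nth x s i.-1).
    by rewrite r_sym -nth_size -i_size -{2}(prednK i0) nthS // prednK.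
  by rewrite (le1 y w _ dy uw yi) mem_s // (leq_trans (leq_pred i) ip).
apply/negP=> /connectP[q xq z_last].
have zs : z \in s.
  have: x \in s by rewrite mem_head.
  elim: q (x) xq z_last => [|u q IHq] t /= => [_ -> //|/andP[tu uq] z_last ts].
  exact: IHq uq z_last (s_closed _ _ ts tu).
case/(nthP x): zs => i; rewrite /= ltnS => ip zi.
have i0 : 0 < i by rewrite lt0n; apply: contraNneq xz => i0; rewrite -zi i0.
have i_lt : i < size p.
  rewrite ltn_neqAle ip andbT; apply: contraNneq yz => i_size.
  by rewrite -zi i_size nth_size.
have [|] := inner i; first by rewrite i0.
rewrite zi => ra rb.
by rewrite (le1 z _ _ dz ra rb) eqxx.
Qed.

End DegreeTwo.

Section Exchange.

Variables (K : finType).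
Implicit Types (TT VV : {set {set K}}) (T F L P : {set K}).

Definition hits TT F := forall T, T \in TT -> exists2 x, x \in F & x \in T.

(* Modelled on a laminar family: [VV] consists of the cuts of the minimal sets
   inside X, and [L] of their elements outside the cut of X. *)
Record local_config TT VV L : Prop := LocalConfig {
  local_sub : VV \subset TT;
  local_out : forall T x, T \in TT -> x \in T -> x \in L -> T \in VV;
  local_deg : forall x, #|[set T in VV | x \in T]| <= 2;
  local_boundary_deg : forall x, x \notin L -> #|[set T in VV | x \in T]| <= 1;
  local_boundary : #|cover VV :\: L| <= 3;
  local_nonempty : exists2 v, v \in VV & exists2 x, x \in v & x \in L
}.

Variables (TT VV : {set {set K}}) (L : {set K}).
Hypothesis TT3 : forall T, T \in TT -> #|T| = 3.
Hypothesis cfg : local_config TT VV L.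

Definition weight (w : K -> nat) F := \sum_(x in F) w x.

(* The third condition says that A + B + e = F1 + F2 as multisets. *)
Definition splits F1 F2 e A B := [/\ hits TT A, hits TT B &
  forall w, weight w A + weight w B + w e = weight w F1 + weight w F2].

Lemma deg_third x u v T : u \in VV -> v \in VV -> T \in VV ->
  x \in u -> x \in v -> x \in T -> u != v -> T != u -> T = v.
Proof.
move=> uV vV TV xu xv xT uv Tu; apply/eqP; apply: contraT => Tv.
suff: 2 < #|[set T in VV | x \in T]| by rewrite ltnNge (local_deg cfg).
by apply/card_gt2P; exists u, v, T; rewrite !inE uV vV TV xu xv xT uv Tu eq_sym Tv.
Qed.

(** [A] is [F1] with its part in [P] exchanged for that of [F2], less [e]; [B] is the opposite
    exchange. Triples outside [VV] avoid [L] and are hit as before. [B] hits [v] and [v'] in [e],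
    whereas [A] hits them in [a] and [s]. *)
Lemma splits_swap F1 F2 v v' e P a s : hits TT F1 -> hits TT F2 ->
  v \in VV -> v' \in VV -> v != v' -> e \in v -> e \in v' -> e \in L ->
  e \in F1 -> e \in F2 -> P \subset L ->
  (forall T, T \in VV -> T != v -> T != v' ->
    exists x y, [/\ x \in F1, y \in F2, x \in T, y \in T &
      x = y \/ (x \in P) = (y \in P)]) ->
  a \in v -> a \in F1 -> a \notin P -> a != e ->
  s \in v' -> s \in F2 -> s \in P -> s != e ->
  exists A B, splits F1 F2 e A B.
Proof.
move=> h1 h2 vV vV' vv' ev ev' eL e1 e2 PL mid av a1 aP ae sv' s2 sP se.
pose sw (G H : {set K}) := [set x | if x \in P then x \in H else x \in G].
exists (sw F1 F2 :\ e), (sw F2 F1); split.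
- move=> T TTT; have [TV|TV] := boolP (T \in VV); last first.
    have [x x1 xT] := h1 T TTT.
    have xL : x \notin L by apply: contra TV; apply: local_out cfg _ _ TTT xT.
    exists x => //; rewrite !inE ifN ?x1 ?andbT.
      by apply: contraNneq xL => ->.
    by apply: contra xL; apply: (subsetP PL).
  have [->|Tv] := eqVneq T v; first by exists a; rewrite // !inE ae (negPf aP).
  have [->|Tv'] := eqVneq T v'; first by exists s; rewrite // !inE se sP.
  have [x [y [x1 y2 xT yT xyP]]] := mid T TV Tv Tv'.
  have neq_e t : t \in T -> t != e.
    by move=> tT; apply: contraNneq Tv' => te; rewrite te in tT;
       rewrite (deg_third vV vV' TV ev ev' tT).
  have [xP|xP] := boolP (x \in P); last by exists x; rewrite // !inE neq_e // (negPf xP).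
  have yP : y \in P by case: xyP => <-.
  by exists y; rewrite // !inE neq_e // yP.
- move=> T TTT; have [TV|TV] := boolP (T \in VV); last first.
    have [x x1 xT] := h2 T TTT.
    have xL : x \notin L by apply: contra TV; apply: local_out cfg _ _ TTT xT.
    by exists x => //; rewrite !inE ifN //; apply: contra xL; apply: (subsetP PL).
  have eB : e \in sw F2 F1 by rewrite inE e1 e2 if_same.
  have [->|Tv] := eqVneq T v; first by exists e.
  have [->|Tv'] := eqVneq T v'; first by exists e.
  have [x [y [x1 y2 xT yT xyP]]] := mid T TV Tv Tv'.
  have [xP|xP] := boolP (x \in P); first by exists x; rewrite // !inE xP.
  have yP : y \notin P by case: xyP => <-.
  by exists y; rewrite // !inE (negPf yP).
move=> w; rewrite /weight.
have -> : w e = \sum_(x in [set e]) w x by rewrite big_set1.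
rewrite ![\sum_(x in _) _]big_mkcond -!big_split; apply: eq_bigr => x _ /=.
rewrite !inE; have [->|_] := eqVneq x e; first by rewrite e1 e2 if_same.
by case: (x \in P); case: (x \in F1); case: (x \in F2); rewrite /= ?addn0 ?add0n.
Qed.

Lemma hits_setD1 F e : hits TT F ->
  (forall T, T \in TT -> e \in T -> exists2 x, x \in F & (x \in T) && (x != e)) ->
  hits TT (F :\ e).
Proof.
move=> hF Fe T TTT; have [eT|eT] := boolP (e \in T).
  by have [x xF /andP[xT xe]] := Fe T TTT eT; exists x; rewrite // !inE xe.
have [x xF xT] := hF T TTT; exists x; rewrite // !inE xF andbT.
by apply: contraNneq eT => <-.
Qed.

Lemma other_element T e : T \in TT -> exists2 x, x \in T & x != e.
Proof.
move=> /TT3 T3; have: 0 < #|T :\ e|.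
  by have := cardsD1 e T; rewrite T3; case: #|T :\ e| => //; case: (e \in T).
by case/card_gt0P=> x /setD1P[xe xT]; exists x.
Qed.

(** As [e] is in [L] and degrees are at most 2, only [v] and [v'] contain [e]. Without [e], [F1]
    still hits [v], which it contains, and hits [v'] in [x]. *)
Lemma splits_drop F1 F2 v v' e x : hits TT F1 -> hits TT F2 ->
  v \in VV -> v' \in VV -> v != v' -> e \in v -> e \in v' -> e \in L ->
  v \subset F1 -> x \in F1 -> x \in v' -> x != e ->
  splits F1 F2 e (F1 :\ e) F2.
Proof.
move=> h1 h2 vV vV' vv' ev ev' eL vF1 x1 xv' xe.
have VT := subsetP (local_sub cfg).
split=> // [|w].
  apply: hits_setD1 => // T TTT eT.
  have TV := local_out cfg TTT eT eL.
  have [->|Tv] := eqVneq T v.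
    by have [y yv ye] := other_element e (VT v vV); exists y; rewrite ?yv ?(subsetP vF1).
  by exists x; rewrite // (deg_third vV vV' TV ev ev' eT) // xv'.
rewrite /weight [in RHS](big_setD1 e) /=; last exact: (subsetP vF1).
by rewrite addnC addnA.
Qed.

Lemma splitsC F1 F2 e A B : splits F2 F1 e A B -> splits F1 F2 e A B.
Proof. by case=> hA hB w_eq; split=> // w; rewrite w_eq addnC. Qed.

(** * The graph of alternating paths *)

Section PairGraph.

Variables (F1 F2 v v' : {set K}) (e : K).
Hypotheses (h1 : hits TT F1) (h2 : hits TT F2).
Hypotheses (vV : v \in VV) (v'V : v' \in VV).

Definition pick1 T := odflt e [pick x in F1 :&: T].
Definition pick2 T := odflt e [pick x in F2 :&: T].

(* A set that is a union of components of this graph can be swapped between [F1]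
   and [F2] while both still hit every triple other than [v] and [v']. A triple
   meeting [F1 :&: F2] imposes no constraint. *)
Definition pair_rel : rel K := [rel x y | [exists T in VV,
  [&& T != v, T != v', [disjoint F1 :&: F2 & T] &
    ((x == pick1 T) && (y == pick2 T)) || ((x == pick2 T) && (y == pick1 T))]]].

Lemma pick1P T : T \in VV -> pick1 T \in F1 :&: T.
Proof.
move=> /(subsetP (local_sub cfg))/h1[x x1 xT]; rewrite /pick1.
by case: pickP => [//|/(_ x)]; rewrite !inE x1 xT.
Qed.

Lemma pick2P T : T \in VV -> pick2 T \in F2 :&: T.
Proof.
move=> /(subsetP (local_sub cfg))/h2[x x2 xT]; rewrite /pick2.
by case: pickP => [//|/(_ x)]; rewrite !inE x2 xT.
Qed.

Lemma pair_rel_sym : symmetric pair_rel.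
Proof.
move=> x y; apply: eq_existsb => T.
by rewrite orbC ![_ && (_ == pick1 T)]andbC ![_ && (_ == pick2 T)]andbC.
Qed.

Definition inner_triples x := [set T in VV | [&& x \in T, T != v & T != v']].

(** An edge at [x] comes from a triple in [inner_triples x], which determines the other end. *)
Lemma pair_rel_deg x : #|pair_rel x| <= #|inner_triples x|.
Proof.
pose other T := if x == pick1 T then pick2 T else pick1 T.
apply: leq_trans (leq_imset_card other _); apply/subset_leq_card/subsetP=> y.
case/existsP=> T /and5P[TV Tv Tv' dT xy].
have /setIP[p11 p1T] := pick1P TV; have /setIP[p22 p2T] := pick2P TV.
apply/imsetP; exists T; first by rewrite !inE TV Tv Tv' !andbT; case/orP: xy => /andP[/eqP-> _].
rewrite /other; case/orP: xy => /andP[/eqP-> /eqP->]; first by rewrite eqxx.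
by case: eqP.
Qed.

Lemma inner_triples_deg2 x : #|inner_triples x| <= 2.
Proof.
apply: leq_trans (local_deg cfg x); apply/subset_leq_card/subsetP=> T.
by rewrite !inE => /and3P[-> ->].
Qed.

Lemma inner_triples_boundary x : x \notin L -> #|inner_triples x| <= 1.
Proof.
move=> /(local_boundary_deg cfg); apply: leq_trans; apply/subset_leq_card/subsetP=> T.
by rewrite !inE => /and3P[-> ->].
Qed.

Lemma inner_triples_end x : x \in v :|: v' ->
  #|inner_triples x| < #|[set T in VV | x \in T]|.
Proof.
move=> xvv'; apply/proper_card/properP; split.
  by apply/subsetP=> T; rewrite !inE => /and3P[-> ->].
by case/setUP: xvv' => xv; [exists v | exists v']; rewrite !inE ?vV ?v'V ?xv ?eqxx ?andbF.
Qed.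

Lemma pair_rel_deg2 x : #|pair_rel x| <= 2.
Proof. exact: leq_trans (pair_rel_deg x) (inner_triples_deg2 x). Qed.

Lemma pair_rel_end x : (x \in v :|: v') || (x \notin L) -> #|pair_rel x| <= 1.
Proof.
move=> x_end; apply: leq_trans (pair_rel_deg x) _.
case/orP: x_end => [xv|/inner_triples_boundary//].
by rewrite -ltnS (leq_trans (inner_triples_end xv)) ?(local_deg cfg).
Qed.

(** The only triple of [VV] through such an [x] is [v] or [v'], and these two give no edges. *)
Lemma pair_rel_isolated x y : x \in v :|: v' -> x \notin L ->
  connect pair_rel x y -> x = y.
Proof.
move=> xv xL /connectP[[//|z p] /= /andP[xz _]].
have := leq_trans (inner_triples_end xv) (local_boundary_deg cfg xL).
rewrite ltnS => N0; have := leq_trans (pair_rel_deg x) N0.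
by rewrite leqNgt; case/negP; apply/card_gt0P; exists z.
Qed.

End PairGraph.

Lemma exchange F1 F2 v v' e : hits TT F1 -> hits TT F2 ->
  v \in VV -> v' \in VV -> v != v' -> e \in v -> e \in v' -> e \in L ->
  v \subset F1 -> v' \subset F2 -> exists A B, splits F1 F2 e A B.
Proof.
move=> h1 h2 vV v'V vv' ev ev' eL vF1 v'F2.
have v'v : v' != v by rewrite eq_sym.
have [x /and3P[x1 xv' xe]|no1] := pickP [pred x | [&& x \in F1, x \in v' & x != e]].
  by exists (F1 :\ e), F2; apply: (splits_drop h1 h2 vV v'V vv' ev ev' eL vF1 x1 xv' xe).
have [x /and3P[x2 xv xe]|no2] := pickP [pred x | [&& x \in F2, x \in v & x != e]].
  exists (F2 :\ e), F1; apply: splitsC.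
  exact: (splits_drop h2 h1 v'V vV v'v ev' ev eL v'F2 x2 xv xe).
have vIv' x : x \in v -> x \in v' -> x = e.
  move=> xv xv'; apply/eqP; apply: contraT => xe.
  by have := no1 x; rewrite /= (subsetP vF1) // xv' xe.
pose Q := (v :|: v') :\ e; pose U := cover VV :\: L.
have VT := subsetP (local_sub cfg).
have Q4 : #|Q| = 4.
  have vI1 : v :&: v' = [set e].
    apply/setP=> x; rewrite !inE; apply/andP/eqP=> [[]|->]; last by rewrite ev ev'.
    exact: vIv'.
  have := cardsD1 e (v :|: v');
  rewrite cardsU vI1 cards1 (TT3 (VT _ vV)) (TT3 (VT _ v'V)) inE ev /=.
  by rewrite -/Q => [[]].
pose r := pair_rel F1 F2 v v' e.
have r_sym : symmetric r by apply: pair_rel_sym.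
have r_csym : connect_sym r by apply: sym_connect_sym.
have r_deg2 x : #|r x| <= 2 by apply: pair_rel_deg2.
have endQ x : x \in Q -> #|r x| <= 1.
  by move=> /setD1P[_ xv]; apply: pair_rel_end; rewrite ?xv.
have endU x : x \in U -> #|r x| <= 1.
  by move=> /setDP[_ xL]; apply: pair_rel_end; rewrite ?xL ?orbT.
have isoQ x y : x \in Q -> x \in U -> connect r x y -> x = y.
  by move=> /setD1P[_ xv] /setDP[_ xL]; apply: pair_rel_isolated.
(* Components of [r] are paths, with ends in [Q] and [U]; as #|U| < #|Q|, not
   every component starting in [Q] can end in [U]. *)
have [s sQ sU] : exists2 s, s \in Q & forall t, t \in U -> ~~ connect r s t.
  have [/exists_inP[s sQ /forall_inP sU]|noS] :=
    boolP [exists s in Q, [forall t in U, ~~ connect r s t]]; first by exists s.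
  pose g s := odflt s [pick t in U | connect r s t].
  have gP s : s \in Q -> (g s \in U) && connect r s (g s).
    move=> sQ; rewrite /g; case: pickP => [t //|noT].
    case/exists_inP: noS; exists s => //; apply/forall_inP=> t tU.
    by have := noT t; rewrite /= tU => /= ->.
  have: #|g @: Q| <= 3.
    apply: leq_trans (local_boundary cfg); apply/subset_leq_card/subsetP=> t.
    by case/imsetP=> s /gP/andP[sU _] ->.
  rewrite card_in_imset ?Q4 // => s s' sQ s'Q gg'.
  have /andP[gU sg] := gP s sQ; have := gP s' s'Q; rewrite -gg' gU /= => s'g.
  apply/eqP; apply: contraT => ss'.
  (* [Q] and [U] may overlap, but a common element is isolated in [r], so it cannot link [s] to
     [s']. *)
  have gs : g s != s.
    apply: contraNneq ss' => gs; rewrite gs in gU s'g; apply/eqP.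
    by apply: isoQ => //; rewrite r_csym.
  have gs' : g s != s'.
    apply: contraNneq ss' => gs'; rewrite gs' in gU sg; apply/eqP/esym.
    by apply: isoQ => //; rewrite r_csym.
  have := connected_ends_le2 r_sym r_deg2 gs gs' ss' (endU _ gU) (endQ _ sQ) (endQ _ s'Q).
  by rewrite r_csym sg r_csym s'g => /(_ isT).
pose P := [set t in cover VV | connect r s t].
have PL : P \subset L.
  apply/subsetP=> t; rewrite inE => /andP[tC st]; apply: contraLR st => tL.
  by apply: sU; rewrite inE tL.
have sP : s \in P.
  rewrite inE connect0 andbT; move: sQ; rewrite !inE => /andP[_].
  by case/orP=> ?; apply/bigcupP; [exists v | exists v'].
have mid T : T \in VV -> T != v -> T != v' ->
    exists x y, [/\ x \in F1, y \in F2, x \in T, y \in T & x = y \/ (x \in P) = (y \in P)].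
  move=> TV Tv Tv'; have [dT|] := boolP [disjoint F1 :&: F2 & T]; last first.
    case/pred0Pn=> x /andP[/setIP[x1 x2] xT]; exists x, x; split=> //; by left.
  have /setIP[p11 p1T] := pick1P e h1 TV; have /setIP[p22 p2T] := pick2P e h2 TV.
  exists (pick1 F1 e T), (pick2 F2 e T); split=> //; right; rewrite !inE.
  have -> : pick1 F1 e T \in cover VV by apply/bigcupP; exists T.
  have -> : pick2 F2 e T \in cover VV by apply/bigcupP; exists T.
  apply: (same_connect_r r_csym); apply: connect1.
  by apply/existsP; exists T; rewrite TV Tv Tv' dT !eqxx.
(* The component of [s] contains at most one other end, so it misses one of the two elements of [u]
   other than [e]. *)
have notP u : u \in VV -> u \subset v :|: v' -> e \in u -> s \notin u ->
    exists a, [/\ a \in u, a \notin P & a != e].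
  move=> uV uvv' eu su; have: 1 < #|u :\ e|.
    by have := cardsD1 e u; rewrite (TT3 (VT _ uV)) eu; case: #|_| => [|[|]].
  case/card_gt1P=> a [b [/setD1P[ae au] /setD1P[be bu] ab]].
  have [aP|aP] := boolP (a \in P); last by exists a.
  exists b; split=> //; apply/negP; move: aP; rewrite !inE => /andP[_ sa] /andP[_].
  have inQ x : x \in u -> x != e -> x \in Q.
    by move=> xu xe; rewrite !inE xe; have := subsetP uvv' x xu; rewrite inE.
  apply/negP; apply: connected_ends_le2 sa => //; rewrite ?(endQ _ sQ) ?endQ ?inQ //.
    by apply: contraNneq su => ->.
  by apply: contraNneq su => ->.
(* [splits_swap] wants [s] in its second triple; if [s] is in [v], the two covers trade roles. *)
have [se sv] := setD1P sQ; case/setUP: sv => sv.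
  have sv' : s \notin v' by apply: contra se => /(vIv' s sv)->.
  have [a [av' aP ae]] := notP v' v'V (subsetUr _ _) ev' sv'.
  have [A [B AB]] : exists A B, splits F2 F1 e A B.
    apply: (@splits_swap F2 F1 v' v e P a s) => //;
      rewrite ?(subsetP vF1) ?(subsetP v'F2) // => T TV Tv' Tv.
    have [x [y [? ? ? ? xy]]] := mid T TV Tv Tv'; exists y, x; split=> //.
    by case: xy => ->; [left | right].
  by exists A, B; apply: splitsC.
have sv' : s \notin v by apply: contra se => sv'; rewrite (vIv' s sv' sv).
have [a [av aP ae]] := notP v vV (subsetUl _ _) ev sv'.
by apply: (@splits_swap F1 F2 v v' e P a s) => //;
  rewrite ?(subsetP vF1) ?(subsetP v'F2).
Qed.

End Exchange.

(** * Induction on the remaining elements *)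

Section Blowup.

Variables (E K : finType) (pi : E -> K) (TT : {set {set K}}).
Implicit Types (D : {set E}) (F v : {set K}) (P : {set {set E}}).
Hypothesis TT3 : forall T, T \in TT -> #|T| = 3.

(* [TT] lives on the parallel classes, the fibres of [pi], and packings on the
   elements themselves. *)
Definition blowup_packing D P := trivIset P /\
  forall T, T \in P -> [/\ T \subset D, #|T| = 3 & pi @: T \in TT].

Lemma imset_lift D v : v \subset pi @: D ->
  exists T : {set E}, [/\ T \subset D, pi @: T = v & {in T &, injective pi}].
Proof.
move=> vD; have [x0 _|noE] := pickP (@predT E); last first.
  exists set0; rewrite sub0set imset0; split=> // [|x y]; last by rewrite inE.
  apply/esym/eqP; rewrite -subset0; apply/subsetP=> x /(subsetP vD)/imsetP[y].
  by have := noE y.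
pose h k := odflt x0 [pick x in D | pi x == k].
have hP k : k \in v -> h k \in D /\ pi (h k) = k.
  move=> /(subsetP vD)/imsetP[x xD ->]; rewrite /h.
  by case: pickP => [y /andP[yD /eqP]//|/(_ x)]; rewrite xD eqxx.
exists (h @: v); split.
- by apply/subsetP=> _ /imsetP[k /hP[hD _] ->].
- rewrite -imset_comp -[RHS]imset_id; apply: eq_in_imset => k /hP[_].
  by [].
- by move=> _ _ /imsetP[k /hP[_ kh] ->] /imsetP[l /hP[_ lh] ->]; rewrite kh lh => ->.
Qed.

Lemma card_preim_triple F v (T : {set E}) : {in T &, injective pi} -> pi @: T = v ->
  #|T :&: pi @^-1: F| = #|F :&: v|.
Proof.
move=> injT defv; rewrite -(@card_in_imset _ _ pi); last first.
  by move=> x y /setIP[xT _] /setIP[yT _]; apply: injT.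
apply: eq_card => k; apply/imsetP/setIP=> [[x /setIP[xT]]|[kF]].
  by rewrite inE => xF ->; rewrite xF -defv imset_f.
by rewrite -defv => /imsetP[x xT kx]; exists x; rewrite // !inE xT -kx.
Qed.

(** With fibre sizes as weights, the multiset identity in [splits] speaks of the sizes of
    pulled-back covers. *)
Lemma card_preim_weight D F :
  #|D :&: pi @^-1: F| = weight (fun k => #|D :&: pi @^-1: [set k]|) F.
Proof.
rewrite /weight -[LHS]sum1_card (partition_big pi (mem F)) /=; last first.
  by move=> x; rewrite !inE => /andP[].
apply: eq_bigr => k kF; rewrite -sum1_card; apply: eq_bigl => x.
by rewrite !inE; case: eqP => [->|]; rewrite ?kF ?andbT ?andbF.
Qed.

Lemma packing_setU1 D P (T : {set E}) : T \subset D -> #|T| = 3 -> pi @: T \in TT ->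
  blowup_packing (D :\: T) P -> blowup_packing D (T |: P) /\ #|T |: P| = #|P|.+1.
Proof.
move=> TD T3 TTT [tP PP].
have dT S : S \in P -> [disjoint T & S].
  by move=> /PP[]; rewrite subsetD disjoint_sym => /andP[].
split; last first.
  rewrite cardsU1; case: (boolP (T \in P)) => // /dT.
  by rewrite -setI_eq0 setIid -cards_eq0 T3.
split=> [|S /setU1P[->//|/PP[SD S3 ST]]]; last first.
  by split=> //; apply: subset_trans SD (subsetDl _ _).
apply/trivIsetP=> A B /setU1P[->|AP] /setU1P[->|BP]; rewrite ?eqxx // => AB.
- exact: dT.
- by rewrite disjoint_sym dT.
- by move/trivIsetP: tP; apply.
Qed.

(** Configurations are assumed for all nonempty subfamilies because deleting elements removes
    triples from the family. *)
Lemma cover_le_packing D :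
  (forall TT' : {set {set K}}, TT' \subset TT -> TT' != set0 ->
    exists VV L, local_config TT' VV L) ->
  exists F P, [/\ hits TT F, blowup_packing D P & #|D :&: pi @^-1: F| <= 2 * #|P|].
Proof.
move=> cfgs; have [n] := ubnP #|D|; elim: n D => // n IHn D; rewrite ltnS => leDn.
pose wt F := #|D :&: pi @^-1: F|.
have wt_sub F F' : F \subset F' -> wt F <= wt F'.
  by move=> FF'; rewrite subset_leq_card // setIS // preimsetS.
(* Points of [Z] have empty fibres in [D]: adding them to a cover hits, at no cost, the triples not
   contained in the image of [D]. *)
pose Z := ~: (pi @: D); pose TT' := [set T in TT | T \subset pi @: D].
have TT'P T : T \in TT' -> T \in TT /\ T \subset pi @: D by rewrite inE => /andP[].
have addZ F : hits TT' F -> hits TT (F :|: Z) /\ wt (F :|: Z) = wt F.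
  move=> hF; split=> [T TTT|].
    have [TD|/subsetPn[x xT xD]] := boolP (T \subset pi @: D).
      have [|x xF xT] := hF T; first by rewrite inE TTT.
      by exists x; rewrite // inE xF.
    by exists x; rewrite // !inE xD orbT.
  apply: eq_card => x; rewrite !inE; have [xD|//] := boolP (x \in D).
  by rewrite imset_f ?orbF.
have TT'3 T : T \in TT' -> #|T| = 3 by case/TT'P=> /TT3.
have [TT'0|TT'n0] := eqVneq TT' set0.
  exists (set0 :|: Z), set0; have [|hZ wZ] := addZ set0.
    by rewrite TT'0 => T; rewrite inE.
  split=> //; last by rewrite -/(wt _) wZ /wt preimset0 setI0 !cards0.
  by split=> [|T]; [apply/trivIsetP=> A B | ]; rewrite inE.
have [||VV [L cfg]] := cfgs TT' => //; first by apply/subsetP=> T /TT'P[].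
(* The lift [T] of [v] raises the bound by 2 and the cost by [#|F0 :&: v|], which is at most 2
   unless [F0] contains [v]. Subsets [F0] are allowed because [e] may later be dropped from [F]. *)
have step v : v \in TT' -> exists F P, [/\ hits TT' F, blowup_packing D P &
    forall F0, F0 \subset F -> wt F0 + 2 <= 2 * #|P| + #|F0 :&: v|].
  move=> vTT'; have [vTT vD] := TT'P v vTT'.
  have [T [TD Tv Tinj]] := imset_lift vD.
  have T3 : #|T| = 3 by rewrite -(card_in_imset Tinj) Tv TT3.
  have [|F [P [hF packP leFP]]] := IHn (D :\: T).
    apply: leq_trans leDn; rewrite -[X in _ < X](cardsID T) (setIidPr TD) T3.
    by rewrite -[X in X < _]add0n ltn_add2r.
  exists F, (T |: P); have [] := packing_setU1 TD T3 _ packP; rewrite ?Tv // => packTP ->.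
  split=> // [U /TT'P[]|F0 F0F]; first by move/hF.
  have -> : wt F0 = #|(D :\: T) :&: pi @^-1: F0| + #|T :&: pi @^-1: F0|.
    rewrite /wt -(cardsID T (D :&: _)) addnC setIDAC; congr (_ + _).
    by rewrite setIAC (setIidPr TD).
  rewrite (card_preim_triple _ Tinj Tv) mulnS addnAC leq_add2r [X in _ <= X]addnC leq_add2r.
  by apply: leq_trans leFP; rewrite subset_leq_card // setIS // preimsetS.
have finish F P : hits TT' F -> blowup_packing D P -> wt F <= 2 * #|P| ->
    exists F P, [/\ hits TT F, blowup_packing D P & wt F <= 2 * #|P|].
  by move=> /addZ[hF wF] packP leF; exists (F :|: Z), P; rewrite -/(wt _) wF.
have VT := subsetP (local_sub cfg).
have [v vV [e ev eL]] := local_nonempty cfg.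
have cardIv F u : u \in VV -> ~~ (u \subset F) -> #|F :&: u| <= 2.
  move=> uV /subsetPn[x xu xF]; rewrite -ltnS -(TT'3 u (VT _ uV)).
  apply/proper_card/properP; split; first exact: subsetIr.
  by exists x; rewrite // inE (negPf xF).
have finish_sub F F0 P u : u \in VV -> hits TT' F0 -> blowup_packing D P ->
    (forall F0, F0 \subset F -> wt F0 + 2 <= 2 * #|P| + #|F0 :&: u|) ->
    F0 \subset F -> ~~ (u \subset F0) ->
    exists F P, [/\ hits TT F, blowup_packing D P & wt F <= 2 * #|P|].
  move=> uV hF packP leF F0F uF0; apply: (finish F0 P) => //.
  by rewrite -(leq_add2r 2) (leq_trans (leF _ F0F)) // leq_add2l cardIv.
have [F1 [P1 [h1 pack1 le1]]] := step v (VT v vV).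
have [vF1|vF1] := boolP (v \subset F1); last exact: (finish_sub F1 F1 P1 v).
have [v' /and3P[v'V ev' v'v]|only_v] := pickP [pred T in VV | (e \in T) && (T != v)]; last first.
  apply: (finish_sub F1 (F1 :\ e) P1 v) => //; last first.
  - by apply/subsetPn; exists e; rewrite // !inE eqxx.
  - exact: subsetDl.
  apply: hits_setD1 => // T TTT eT.
  have TV := local_out cfg TTT eT eL.
  have -> : T = v by apply/eqP; have := only_v T; rewrite /= TV eT => /negbFE.
  have [x xv xe] := other_element TT'3 e (VT v vV).
  by exists x; rewrite ?xv // (subsetP vF1).
have [F2 [P2 [h2 pack2 le2]]] := step v' (VT v' v'V).
have [v'F2|v'F2] := boolP (v' \subset F2); last exact: (finish_sub F2 F2 P2 v').
have vv' : v != v' by rewrite eq_sym.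
have [A [B [hA hB wAB]]] := exchange TT'3 cfg h1 h2 vV v'V vv' ev ev' eL vF1 v'F2.
have /= := wAB (fun k => #|D :&: pi @^-1: [set k]|); rewrite -!card_preim_weight -/(wt _) => wtAB.
(* The copy of [e] that is dropped saves at least one element of [D]. *)
have e_gt0 : 0 < #|D :&: pi @^-1: [set e]|.
  have [_ /subsetP/(_ e ev)/imsetP[x xD ex]] := TT'P v (VT v vV).
  by apply/card_gt0P; exists x; rewrite !inE xD -ex eqxx.
have leF u F P : u \in VV -> u \subset F ->
    (forall F0, F0 \subset F -> wt F0 + 2 <= 2 * #|P| + #|F0 :&: u|) ->
    wt F <= 2 * #|P| + 1.
  move=> uV uF /(_ F (subxx _)); rewrite (setIidPr uF) (TT'3 u (VT u uV)).
  by rewrite -[3]/(1 + 2) addnA leq_add2r.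
have leF1 := leF v F1 P1 vV vF1 le1; have leF2 := leF v' F2 P2 v'V v'F2 le2.
(* If [A] and [B] both cost more than [2 * #|P|], their total is at least [4 * #|P| + 2]; but it is
   less than the total of [F1] and [F2], which is at most that. *)
have best P : blowup_packing D P -> #|P1| <= #|P| -> #|P2| <= #|P| ->
    exists F P, [/\ hits TT F, blowup_packing D P & wt F <= 2 * #|P|].
  move=> packP leP1 leP2.
  have [leA|ltA] := leqP (wt A) (2 * #|P|); first exact: finish hA packP leA.
  apply: finish hB packP _; rewrite leqNgt; apply/negP=> ltB.
  have le_mul a b : a <= b -> 2 * a + 1 <= (2 * b).+1 by rewrite addn1 ltnS leq_mul2l.
  have := leq_add (leq_trans leF1 (le_mul _ _ leP1)) (leq_trans leF2 (le_mul _ _ leP2)).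
  rewrite -wtAB leqNgt => /negP[]; apply: leq_ltn_trans (leq_add ltA ltB) _.
  by rewrite -[X in X < _]addn0 ltn_add2l.
by case/orP: (leq_total #|P1| #|P2|) => leP; [apply: (best P2) | apply: (best P1)].
Qed.

End Blowup.

(** * Laminar families of 3-edge cuts *)

Section Cuts.

Variables (V E : finType) (en : E -> V * V).
Implicit Types (R S : {set V}) (C T X : {set E}) (TT : {set {set E}}).

Definition symdiff (K : finType) (A B : {set K}) := [set x | (x \in A) (+) (x \in B)].

Definition cut S : {set E} := [set x | ((en x).1 \in S) (+) ((en x).2 \in S)].

Lemma cut_symdiff R S : cut (symdiff R S) = symdiff (cut R) (cut S).
Proof. by apply/setP=> x; rewrite !inE addbACA. Qed.

(** Counting by indicators reduces the statements on cut sizes to case checks on a single edge. *)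
Lemma card_sum_mem (A : {set E}) : #|A| = \sum_x (x \in A).
Proof. by rewrite -sum1_card big_mkcond; apply: eq_bigr => x _; case: (x \in A). Qed.

Lemma cut_submod R S : #|cut (R :&: S)| + #|cut (R :|: S)| <= #|cut R| + #|cut S|.
Proof.
rewrite !card_sum_mem -!big_split; apply: leq_sum => x _ /=; rewrite !inE.
by do 2 case: (_ \in R); do 2 case: (_ \in S).
Qed.

Lemma cut_posimod R S : #|cut (R :\: S)| + #|cut (S :\: R)| <= #|cut R| + #|cut S|.
Proof.
rewrite !card_sum_mem -!big_split; apply: leq_sum => x _ /=; rewrite !inE.
by do 2 case: (_ \in R); do 2 case: (_ \in S).
Qed.

(** The two smaller cuts overlap in the edges between [R :&: S] and [R :\: S]; their other edges
    make up [cut R]. *)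
Lemma odd_cut_split R S :
  odd #|cut R| = odd #|cut (R :&: S)| (+) odd #|cut (R :\: S)|.
Proof.
rewrite -oddD.
suff -> : #|cut (R :&: S)| + #|cut (R :\: S)| =
    #|cut R| + #|cut (R :&: S) :&: cut (R :\: S)|.*2.
  by rewrite oddD odd_double addbF.
rewrite -muln2 !card_sum_mem big_distrl -!big_split /=.
by apply: eq_bigr => x _; rewrite !inE; do 2 case: (_ \in R); do 2 case: (_ \in S).
Qed.

(** The sides strictly inside [X] are disjoint, so an edge is cut by at most one of them per end. An
    edge of [cut X] has only one end in [X], hence degree at most 1. *)
Lemma laminar_config TT (S : {set E} -> {set V}) : TT != set0 ->
  (forall T, T \in TT -> #|T| = 3) -> (forall T, T \in TT -> cut (S T) = T) ->
  (forall T T', T \in TT -> T' \in TT ->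
    [|| S T :&: S T' == set0, S T \subset S T' | S T' \subset S T]) ->
  exists VV L, local_config TT VV L.
Proof.
move=> TTn0 TT3 cutS lam.
have S_inj T T' : T \in TT -> T' \in TT -> S T = S T' -> T = T'.
  by move=> /cutS{2}<- /cutS{2}<- ->.
pose inside (X : {set V}) := [set T in TT | S T \proper X].
have config (X : {set V}) : (forall T, T \in TT ->
      [|| S T :&: X == set0, S T \subset X | X \subset S T]) ->
    (forall T, T \in inside X -> inside (S T) = set0) ->
    inside X != set0 -> #|cut X| <= 3 ->
    (forall T, T \in inside X -> ~~ (T \subset cut X)) ->
    exists VV L, local_config TT VV L.
  move=> lamX leaf /set0Pn[v vX] X3 notX.
  exists (inside X), (cover (inside X) :\: cut X).
  have inTT T : T \in inside X -> T \in TT by rewrite inE => /andP[].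
  have inX T : T \in inside X -> S T \subset X by rewrite inE => /andP[_ /proper_sub].
  have in_cut T x : T \in inside X -> (x \in T) = ((en x).1 \in S T) (+) ((en x).2 \in S T).
    by move=> /inTT/cutS{1}<-; rewrite inE.
  have disj T T' u : T \in inside X -> T' \in inside X -> u \in S T -> u \in S T' -> T = T'.
    move=> TX T'X uT uT'; apply: S_inj (inTT _ TX) (inTT _ T'X) _.
    case/or3P: (lam _ _ (inTT _ TX) (inTT _ T'X)) => [/eqP/setP/(_ u)||].
    - by rewrite !inE uT uT'.
    - rewrite subEproper => /predU1P[//|TT'].
      by have := leaf _ T'X => /setP/(_ T); rewrite !inE TT' (inTT _ TX).
    rewrite subEproper => /predU1P[//|TT'].
    by have := leaf _ TX => /setP/(_ T'); rewrite !inE TT' (inTT _ T'X).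
  have same_end T T' x : T \in inside X -> T' \in inside X -> x \in T -> x \in T' ->
      ((en x).1 \in S T) = ((en x).1 \in S T') -> T = T'.
    move=> TX T'X; rewrite (in_cut _ _ TX) (in_cut _ _ T'X).
    have [x1 _|x1] := boolP ((en x).1 \in S T).
      by move=> _ /esym; apply: disj x1.
    move=> x2 + /esym/negbT/negPf x1'; rewrite x1' => x2'.
    exact: disj x2 x2'.
  split.
  - by apply/subsetP.
  (* An edge that is cut by a side inside [X] but not by [X] has both ends in [X]. As [S T]
     separates these ends, laminarity puts it strictly inside [X]. *)
  - move=> T x TTT xT; rewrite !inE TTT /= => /andP[xX /bigcupP[T1 T1X xT1]].
    have T_cut : ((en x).1 \in S T) (+) ((en x).2 \in S T) by rewrite -(cutS T TTT) inE in xT.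
    have xX12 : ((en x).1 \in X) && ((en x).2 \in X).
      move: xX xT1; rewrite (in_cut _ _ T1X).
      have := introT implyP (subsetP (inX _ T1X) (en x).1).
      have := introT implyP (subsetP (inX _ T1X) (en x).2).
      by do 2 case: (_ \in X); do 2 case: (_ \in S T1).
    case/andP: xX12 => x1X x2X; rewrite properE.
    case/or3P: (lamX T TTT) => [/eqP/setP ST0|STX|XST].
    + have := ST0 (en x).1; have := ST0 (en x).2; rewrite !inE x1X x2X !andbT => x2 x1.
      by rewrite x1 x2 in T_cut.
    + rewrite STX; apply/negP=> XST.
      by rewrite !(subsetP XST) in T_cut.
    + by rewrite !(subsetP XST) in T_cut.
  (* By [same_end], whether the first end of [x] is inside tells the triples through [x] apart. *)
  - move=> x; rewrite -card_bool.
    rewrite -(@card_in_imset _ _ (fun T => (en x).1 \in S T)) ?max_card // => T T'.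
    by move=> /setIdP[TX xT] /setIdP[T'X xT']; apply: same_end xT xT'.
  - move=> x; rewrite inE negb_and negbK => xL.
    apply/card_le1_eqP => T T' /setIdP[TX xT] /setIdP[T'X xT'].
    have xX : x \in cut X by case/orP: xL => // /negP[]; apply/bigcupP; exists T.
    have end_X U : U \in inside X -> x \in U -> ((en x).1 \in S U) = ((en x).1 \in X).
      move=> UX; move: xX; rewrite inE (in_cut _ _ UX).
      have := introT implyP (subsetP (inX _ UX) (en x).1).
      have := introT implyP (subsetP (inX _ UX) (en x).2).
      by do 2 case: (_ \in X); do 2 case: (_ \in S U).
    by apply: (same_end _ _ x); rewrite // !end_X.
  - apply: leq_trans X3; apply/subset_leq_card/subsetP=> x.
    by rewrite !inE negb_and negbK => /andP[/orP[//|/negPf->]].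
  - exists v => //; have /subsetPn[x xv xX] := notX v vX.
    by exists x => //; rewrite inE xX; apply/bigcupP; exists v.
have [/exists_inP[T0 T0T T0n]|leaves] := boolP [exists T in TT, inside (S T) != set0].
  have T0P : (T0 \in TT) && (inside (S T0) != set0) by rewrite T0T.
  case: (@arg_minnP _ T0 (fun T => (T \in TT) && (inside (S T) != set0)) (fun T => #|S T|) T0P).
  move=> T1 /andP[T1T T1n] T1min; apply: (config (S T1)) => // [T TTT|T||T].
  - exact: lam.
  - rewrite inE => /andP[TTT TT1]; apply/eqP; apply: contraT => Tn.
    by have := T1min T; rewrite TTT Tn leqNgt proper_card // => /(_ isT).
  - by rewrite cutS // TT3.
  - rewrite inE cutS // => /andP[TTT TT1]; apply: contraL TT1 => TT1.
    suff -> : T = T1 by rewrite properxx.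
    by apply/eqP; rewrite eqEcard TT1 !TT3.
have cutT : cut setT = set0 by apply/setP=> x; rewrite !inE.
apply: (config setT) => [T _|T||| T].
- by rewrite subsetT orbT.
- rewrite inE => /andP[TTT _]; apply/eqP; apply: contraNT leaves => Tn.
  by apply/exists_inP; exists T.
- case/set0Pn: TTn0 => T TTT; apply/set0Pn; exists T; rewrite inE TTT properT.
  by apply/eqP=> ST; have := TT3 T TTT; rewrite -(cutS T TTT) ST cutT cards0.
- by rewrite cutT cards0.
- by rewrite inE cutT subset0 -cards_eq0 => /andP[/TT3-> _].
Qed.

(** * Normalized sides of cuts *)

Definition edge_rel : rel V := [rel u w | [exists x, (en x == (u, w)) || (en x == (w, u))]].

(** A cut determines its side only up to complementation within components; excluding the roots
    selects one side. *)
Definition rootless S := [forall u in S, ~~ roots edge_rel u].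

Lemma edge_rel_csym : connect_sym edge_rel.
Proof. by apply: sym_connect_sym => u w; apply: eq_existsb => x; rewrite orbC. Qed.

Lemma edge_rel_ends x : edge_rel (en x).1 (en x).2.
Proof. by apply/existsP; exists x; rewrite -surjective_pairing eqxx. Qed.

(** With an empty cut, [S] would be a union of components and contain their roots. *)
Lemma cut_rootless S : rootless S -> S != set0 -> cut S != set0.
Proof.
move=> /forall_inP rS /set0Pn[u uS]; apply: contraL (uS) => /eqP/setP cut0.
have S_closed : closed edge_rel (mem S).
  move=> v w /existsP[x] xvw; have := cut0 x; rewrite !inE.
  by case/orP: xvw => /eqP->; do 2 case: (_ \in S).
apply/negP=> _; have := rS (root edge_rel u); rewrite (roots_root edge_rel_csym).
by rewrite -[_ \in S](closed_connect S_closed (connect_root _ _)) uS => /(_ isT).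
Qed.

(* Complementing S inside the components whose root lies in S keeps the cut. *)
Lemma cut_normalize S : exists2 R, rootless R & cut R = cut S.
Proof.
exists [set u | (u \in S) (+) (root edge_rel u \in S)].
  apply/forall_inP=> u; rewrite inE; apply: contraL => /eqP->.
  by rewrite addbb.
apply/setP=> x; rewrite !inE.
have -> : root edge_rel (en x).2 = root edge_rel (en x).1.
  apply/eqP; rewrite (root_connect edge_rel_csym) edge_rel_csym.
  exact: connect1 (edge_rel_ends x).
by rewrite addbACA addbb addbF.
Qed.

(* If [R] and [S] crossed, the four corner cuts would have at least 3 edges each,
   and at most 12 in total; but two of them split the odd cut of [R], so that
   they have at least 7 edges. *)
Lemma cut3_laminar R S : rootless R -> rootless S -> #|cut R| = 3 -> #|cut S| = 3 ->
  (forall X : {set V}, cut X != set0 -> cut X \subset cut R :|: cut S -> 3 <= #|cut X|) ->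
  [|| R :&: S == set0, R \subset S | S \subset R].
Proof.
move=> /forall_inP rR /forall_inP rS R3 S3 le3.
have corner (X : {set V}) : X \subset R :|: S -> cut X \subset cut R :|: cut S -> X != set0 ->
    3 <= #|cut X|.
  move=> XRS cX X0; apply: le3 cX; apply: cut_rootless X0; apply/forall_inP=> u.
  by move/(subsetP XRS)/setUP=> [/rR|/rS].
apply: contraT; rewrite !negb_or -!setD_eq0 => /and3P[RIS RDS SDR].
have cI := corner (R :&: S); have cU := corner (R :|: S).
have cRD := corner (R :\: S); have cSD := corner (S :\: R).
have U0 : R :|: S != set0.
  by apply: contraNneq RIS => /setP U0;
    apply/eqP/setP=> u; have := U0 u; rewrite !inE; case: (u \in R).
have cut_sub (h : bool -> bool -> bool) :
    cut [set u | h (u \in R) (u \in S)] \subset cut R :|: cut S.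
  apply/subsetP=> x; rewrite !inE.
  by do 2 case: (_ \in R); do 2 case: (_ \in S); rewrite //= addbb.
have := odd_cut_split R S; have := cut_submod R S; have := cut_posimod R S.
rewrite R3 S3 /= => pos sub.
have {}cI : 3 <= #|cut (R :&: S)|.
  apply: cI => //; first by rewrite subIset // subsetUl.
  exact: (cut_sub andb).
have {}cU : 3 <= #|cut (R :|: S)| by apply: cU => //; apply: (cut_sub orb).
have {}cRD : 3 <= #|cut (R :\: S)|.
  apply: cRD => //; first exact: subset_trans (subsetDl _ _) (subsetUl _ _).
  exact: (cut_sub (fun a b => ~~ b && a)).
have {}cSD : 3 <= #|cut (S :\: R)|.
  apply: cSD => //; first exact: subset_trans (subsetDl _ _) (subsetUr _ _).
  exact: (cut_sub (fun a b => ~~ a && b)).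
(* Two cuts of at least 3 edges and at most 6 in total have exactly 3 each. Then [odd_cut_split]
   fails, since 3 is odd. *)
have le_3 a b : 3 <= b -> a + b <= 6 -> a <= 3.
  by move=> b3 ab; rewrite -(leq_add2r 3) (leq_trans _ ab) // leq_add2l.
have -> : #|cut (R :&: S)| = 3 by apply/eqP; rewrite eqn_leq cI (le_3 _ _ cU sub).
by have -> : #|cut (R :\: S)| = 3 by apply/eqP; rewrite eqn_leq cRD (le_3 _ _ cSD pos).
Qed.

End Cuts.

(** * Triangles of a cographic matroid *)

Section CographicCircuits.

Variables (E : finType) (M : matroid E) (G : multigraph) (f : E -> edge G).
Hypothesis f_bij : bijective f.
Hypothesis fP : forall X : {set E}, dual M X = cycle_matroid G (f @: X).

Lemma linked_same_side (F : {set edge G}) (S : {set vertex G}) (d : dart G) :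
  (forall d : dart G, d.1 \in F -> (src d \in S) = (tgt d \in S)) ->
  linked F d -> (src d \in S) = (tgt d \in S).
Proof.
move=> FS; apply: closed_connect => x y /existsP[d1 /and3P[/FS d1S /eqP<- /eqP<-]].
exact: d1S.
Qed.

(** The complement of a basis of [M] is a maximal forest, which no nonempty cut avoids; so
    independent sets contain no such cut. Conversely, for dependent [X], a component of a maximal
    forest outside [X] gives the cut. *)
Lemma dependentP (X : {set E}) :
  reflect (exists2 S, cut (@ends G \o f) S != set0 & cut (@ends G \o f) S \subset X)
          (~~ indep M X).
Proof.
have f_inj := bij_inj f_bij.
have coP Y : coindep M Y = forest (f @: Y) := fP Y.
apply: (iffP idP) => [depX|[S /set0Pn[x xS] SX]]; last first.
  apply/negP=> iX; have [B0 bB0] := basis_exists M.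
  have [C [bC XC _]] := basis_extend iX bB0.
  have coC : coindep M (~: C).
    by apply/existsP; exists C; rewrite bC -setI_eq0 setIC setICr eqxx.
  have : forest (f x |: f @: ~: C).
    rewrite coP in coC; apply: (@forestU1 G _ (f x, true)) => //.
    apply/negP=> /(linked_same_side (S := S)) sameS.
    have xS0 : (src (f x, true) \in S) (+) (tgt (f x, true) \in S) by rewrite inE in xS.
    rewrite sameS ?addbb // in xS0 => -[_ b] /imsetP[y yC /= ->].
    have : y \notin cut (@ends G \o f) S.
      by apply: contraL yC => /(subsetP SX)/(subsetP XC) yC; rewrite inE yC.
    by rewrite inE /src /tgt; case: b; do 2 case: (_ \in S).
  rewrite -imsetU1 -coP => /existsP[B /andP[bB dB]].
  have xC : x \in C by apply: (subsetP XC); apply: (subsetP SX).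
  suff: #|B| < #|C| by rewrite (basis_card bB bC) ltnn.
  apply/proper_card/properP; split; last first.
    by exists x; rewrite // (disjointFr dB) // setU11.
  apply/subsetP=> y yB; apply: contraT => yC.
  by have := disjointFl dB yB; rewrite !inE yC orbT.
have [|Y /maxsetP[/andP[YX coY] maxY] _] := @maxset_exists _
    (fun Y : {set E} => (Y \subset ~: X) && coindep M Y) set0.
  by rewrite sub0set coindep0.
have [B /andP[bB dB]] := existsP coY.
(* A basis avoiding [Y] misses some [x] of the dependent set [X]. So [x] can be added to [Y], whose
   forest therefore does not link the ends of [x]. *)
have [x xB xY] : exists2 x, x \notin B & x \notin Y.
  have /subsetPn[x xX xB] : ~~ (X \subset B).
    apply: contra depX => XB; have [iB _] := maxsetP bB; exact: indepS XB iB.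
  by exists x => //; apply: contraTN xX => /(subsetP YX); rewrite inE.
have maxY' z : z \notin X -> z \notin Y -> ~~ forest (f z |: f @: Y).
  move=> zX; apply: contra; rewrite -imsetU1 -coP => coz.
  by rewrite -(maxY (z |: Y)) ?setU11 ?subsetUr // subUset sub1set inE zX YX.
have cox : forest (f x |: f @: Y).
  rewrite -imsetU1 -coP; apply/existsP; exists B.
  by rewrite bB -setI_eq0 setIUl setU_eq0 !setI_eq0 disjoints1 xB.
have Nx : ~~ linked (f @: Y) (f x, true).
  have := forestD1 (d := (f x, true)) cox (setU11 _ _).
  by rewrite setU1K // mem_imset.
pose S := [set u | connect (adjacent (f @: Y)) (src (f x, true)) u].
exists S; first by apply/set0Pn; exists x; rewrite !inE connect0.
apply/subsetP=> z zS; apply: contraT => zX.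
have Nz : ~~ linked (f @: Y) (f z, true).
  apply/negP=> /(same_connect_r (@linked_sym _ _)) zlink.
  by move: zS; rewrite !inE zlink addbb.
have zY : z \notin Y by apply: contra Nz => zY; apply: linked_in; apply: imset_f.
have := maxY' z zX zY; rewrite (@forestU1 G _ (f z, true)) //.
by rewrite -coP.
Qed.

(** * Bonds and parallel classes *)

Definition is_cut (C : {set E}) := [exists S, cut (@ends G \o f) S == C].

Definition bond (C : {set E}) := minset (fun X => (X != set0) && is_cut X) C.

Lemma circuit_bond C : circuit M C = bond C.
Proof.
apply/minsetP/minsetP=> [[dC minC]|[/andP[C0 /existsP[S /eqP SC]] minC]].
  have [S S0 SC] := dependentP _ dC.
  have CS : cut (@ends G \o f) S = C.
    by apply: minC => //; apply/dependentP; exists S.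
  split=> [|D /andP[D0 /existsP[R /eqP DR]] DC].
    by rewrite -CS S0; apply/existsP; exists S.
  by apply: minC => //; apply/dependentP; exists R; rewrite DR.
split=> [|D /dependentP[R R0 RD] DC]; first by apply/dependentP; exists S; rewrite SC.
apply/eqP; rewrite eqEsubset DC -(minC (cut (@ends G \o f) R)) ?RD //.
  by rewrite R0; apply/existsP; exists R.
exact: subset_trans RD DC.
Qed.

Lemma is_cut_symdiff C D : is_cut C -> is_cut D -> is_cut (symdiff C D).
Proof.
move=> /existsP[R /eqP<-] /existsP[S /eqP<-]; apply/existsP.
by exists (symdiff R S); rewrite cut_symdiff.
Qed.

(** The symmetric difference is empty for equal elements, which gives reflexivity. All loops of [M]
    fall into one class. *)
Definition parallel x y := is_cut (symdiff [set x] [set y]).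

Lemma symdiffxx (C : {set E}) : symdiff C C = set0.
Proof. by apply/setP=> x; rewrite !inE addbb. Qed.

Lemma is_cut0 : is_cut set0.
Proof. by apply/existsP; exists set0; apply/eqP/setP=> x; rewrite !inE. Qed.

Lemma parallel_refl x : parallel x x.
Proof. by rewrite /parallel symdiffxx is_cut0. Qed.

Lemma parallel_sym x y : parallel x y = parallel y x.
Proof. by congr is_cut; apply/setP=> z; rewrite !inE addbC. Qed.

Lemma parallel_trans : transitive parallel.
Proof.
move=> y x z xy yz; suff -> : parallel x z = is_cut (symdiff (symdiff [set x] [set y])
    (symdiff [set y] [set z])) by apply: is_cut_symdiff.
by congr is_cut; apply/setP=> u; rewrite !inE addbA addbK.
Qed.

(** The default is never reached, by reflexivity, so the choice depends only on the class. *)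
Definition rep x := odflt x [pick y | parallel x y].

Lemma parallel_rep x : parallel x (rep x).
Proof. by rewrite /rep; case: pickP => // _; apply: parallel_refl. Qed.

Lemma eq_rep x y : parallel x y -> rep x = rep y.
Proof.
move=> xy; rewrite /rep (@eq_pick _ _ (parallel y)) => [|z].
  by case: pickP => // /(_ y); rewrite parallel_refl.
apply/idP/idP; apply: parallel_trans => //; by rewrite parallel_sym.
Qed.

Lemma rep_id x : rep (rep x) = rep x.
Proof. by rewrite -(eq_rep (parallel_rep x)). Qed.

(** Replacing [x] by [rep x] adds the cut [symdiff [set x] [set rep x]]. By injectivity nothing
    cancels among the images, so the sum of these cuts is [symdiff C (rep @: C)]. *)
Lemma is_cut_rep (C : {set E}) : {in C &, injective rep} -> is_cut C = is_cut (rep @: C).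
Proof.
move=> injC; suff cutD : is_cut (symdiff C (rep @: C)).
  have symK (A B : {set E}) : symdiff A (symdiff A B) = B.
    by apply/setP=> x; rewrite !inE addKb.
  have symC (A B : {set E}) : symdiff A B = symdiff B A.
    by apply/setP=> x; rewrite !inE addbC.
  apply/idP/idP=> cutC; first by rewrite -[rep @: C](symK C); apply: is_cut_symdiff.
  by rewrite -[C](symK (rep @: C)); apply: is_cut_symdiff; rewrite // symC.
have [n] := ubnP #|C|; elim: n C injC => // n IHn C injC ltC.
have [->|[x xC]] := set_0Vmem C; first by rewrite imset0 symdiffxx is_cut0.
have xC' : rep x \notin rep @: (C :\ x).
  by apply/imsetP=> -[y /setD1P[yx yC] /(injC _ _ xC yC) xy]; rewrite xy eqxx in yx.
have cutC' : is_cut (symdiff (C :\ x) (rep @: (C :\ x))).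
  apply: IHn => [y z /setD1P[_ yC] /setD1P[_ zC]|]; first exact: injC.
  by move: ltC; rewrite ltnS (cardsD1 x) xC.
have -> : symdiff C (rep @: C) =
    symdiff (symdiff [set x] [set rep x]) (symdiff (C :\ x) (rep @: (C :\ x))).
  have xC0 : x \notin C :\ x by rewrite setD11.
  rewrite -{1 2}(setD1K xC) imsetU1; move: (C :\ x) xC0 xC' => D xD rxD.
  apply/setP=> y; rewrite !inE.
  have yx : y == x -> (y \in D) = false by move/eqP->; apply: negPf.
  have yrx : y == rep x -> (y \in rep @: D) = false by move/eqP->; apply: negPf.
  case: (y == x) yx => [/(_ isT)->|_]; case: (y == rep x) yrx => [/(_ isT)->|_] //=;
    by do ?case: (y \in _).
by apply: is_cut_symdiff => //; apply: parallel_rep.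
Qed.

Lemma bond_rep (C : {set E}) : {in C &, injective rep} -> bond C = bond (rep @: C).
Proof.
move=> injC; have injS (D : {set E}) : D \subset C -> {in D &, injective rep}.
  by move=> DC x y /(subsetP DC) xC /(subsetP DC); apply: injC.
have im0 (D : {set E}) : (rep @: D == set0) = (D == set0) by rewrite imset_eq0.
apply/minsetP/minsetP=> -[/andP[C0 cutC] minC]; split.
- by rewrite im0 C0 -is_cut_rep.
- move=> D' /andP[D'0 cutD'] D'C.
  have defD' : rep @: (C :&: rep @^-1: D') = D'.
    apply/setP=> y; apply/imsetP/idP=> [[x /setIP[_]]|yD']; first by rewrite inE => ? ->.
    have /imsetP[x xC yx] := subsetP D'C y yD'.
    by exists x; rewrite // !inE xC -yx.
  have D_C := subsetIl C (rep @^-1: D').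
  rewrite -{1}defD' (minC _ _ D_C) // (is_cut_rep (injS _ D_C)) defD' cutD' andbT.
  by rewrite -im0 defD'.
- by rewrite -im0 C0 (is_cut_rep injC).
move=> D /andP[D0 cutD] DC; have := minC (rep @: D).
rewrite im0 D0 -(is_cut_rep (injS D DC)) cutD imsetS // => /(_ isT isT) DC_im.
by apply/eqP; rewrite eqEcard DC -(card_in_imset injC) -DC_im leq_imset_card.
Qed.

(** Otherwise [[set x; y]] is a nonempty cut strictly inside the bond. *)
Lemma bond_nparallel (C : {set E}) x y : bond C -> 2 < #|C| -> x \in C -> y \in C ->
  parallel x y -> x = y.
Proof.
move=> /minsetP[_ minC] C3 xC yC xy; apply/eqP; apply: contraT => neq_xy.
have sxy : symdiff [set x] [set y] = [set x; y].
  apply/setP=> z; rewrite !inE; have [->|] := eqVneq z x; last by [].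
  by rewrite (negPf neq_xy).
have cxy : is_cut [set x; y] by rewrite -sxy.
have := minC [set x; y]; rewrite -card_gt0 cards2 neq_xy cxy subUset !sub1set xC yC.
by move=> /(_ isT isT) defC; rewrite -defC cards2 neq_xy in C3.
Qed.

(** The triangles of the restriction of [M] to one representative per parallel class. *)
Definition simple_triangles := [set T : {set E} |
  [&& bond T, #|T| == 3 & T \subset [set x | rep x == x]]].

Lemma simple_triangle_rep (T : {set E}) : triangle M T -> rep @: T \in simple_triangles.
Proof.
rewrite /triangle circuit_bond => /andP[bT /eqP T3].
have injT : {in T &, injective rep}.
  move=> x y xT yT xy; apply: (bond_nparallel bT) => //; first by rewrite T3.
  apply: parallel_trans (parallel_rep x) _; rewrite xy parallel_sym; exact: parallel_rep.
rewrite inE -bond_rep // bT card_in_imset // T3 eqxx.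
by apply/subsetP=> _ /imsetP[x _ ->]; rewrite inE rep_id eqxx.
Qed.

Lemma triangle_of_rep (T : {set E}) : #|T| = 3 -> rep @: T \in simple_triangles ->
  triangle M T.
Proof.
rewrite inE => T3 /and3P[bT /eqP rT3 _]; rewrite /triangle circuit_bond T3 eqxx andbT.
by rewrite bond_rep //; apply/imset_injP; rewrite rT3 T3.
Qed.

(** A cut of size 2 would make two distinct representatives parallel; one of size 1 would lie
    strictly inside a bond. *)
Lemma simple_triangles_cut_ge3 T T' S : T \in simple_triangles -> T' \in simple_triangles ->
  cut (@ends G \o f) S != set0 -> cut (@ends G \o f) S \subset T :|: T' ->
  3 <= #|cut (@ends G \o f) S|.
Proof.
set C := cut _ S => TT TT' C0 sC; have cutC : is_cut C by apply/existsP; exists S.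
rewrite leqNgt ltnS; apply/negP=> C2.
have rep_fix U x : U \in simple_triangles -> x \in U -> rep x = x.
  by rewrite inE => /and3P[_ _ /subsetP sU] /sU; rewrite inE => /eqP.
have repC x : x \in C -> rep x = x.
  by move=> /(subsetP sC)/setUP[]; apply: rep_fix.
have [|C1|C_eq1] := ltngtP #|C| 1; first by rewrite ltnNge card_gt0 C0.
  have /cards2P[x [y [xy Cxy]]] : #|C| == 2 by rewrite eqn_leq C2 C1.
  have: parallel x y.
    rewrite /parallel (_ : symdiff _ _ = C) // Cxy; apply/setP=> z; rewrite !inE.
    by have [->|] := eqVneq z x; first by rewrite (negPf xy).
  move/eq_rep; rewrite (repC x) ?(repC y) ?Cxy ?set21 ?set22 // => xy'.
  by rewrite xy' eqxx in xy.
have /eqP/cards1P[x Cx] := C_eq1.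
have [U UT xU] : exists2 U, U \in simple_triangles & x \in U.
  by have := subsetP sC x; rewrite Cx set11 => /(_ isT)/setUP[]; [exists T | exists T'].
have := UT; rewrite inE => /and3P[/minsetP[_ minU] /eqP U3 _].
by have := minU C; rewrite C0 cutC Cx sub1set xU => /(_ isT isT) UC; rewrite -UC cards1 in U3.
Qed.

Lemma simple_triangles_config (TT : {set {set E}}) : TT \subset simple_triangles -> TT != set0 ->
  exists VV L, local_config TT VV L.
Proof.
move=> sTT TT0.
have TTs T : T \in TT -> T \in simple_triangles by apply: subsetP.
have TT3 T : T \in TT -> #|T| = 3 by move/TTs; rewrite inE => /and3P[_ /eqP].
(* Rootless sides, as [cut3_laminar] requires; by [cut_normalize] the default is not reached on
   [TT]. *)
pose side T := odflt set0 [pick S | rootless (@ends G \o f) S && (cut (@ends G \o f) S == T)].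
have sideP T : T \in TT -> rootless (@ends G \o f) (side T) /\ cut (@ends G \o f) (side T) = T.
  move=> /TTs; rewrite inE => /and3P[/minsetP[/andP[_ /existsP[S /eqP ST]] _] _ _].
  have [R rR RS] := cut_normalize (@ends G \o f) S.
  rewrite /side; case: pickP => [U /andP[rU /eqP]|/(_ R)] //=.
  by rewrite rR RS ST eqxx.
apply: (@laminar_config _ _ (@ends G \o f) TT side) => // [T /sideP[]//|T T' TT1 TT2].
have [rT cT] := sideP T TT1; have [rT' cT'] := sideP T' TT2.
apply: (cut3_laminar rT rT'); rewrite ?cT ?cT' ?TT3 // => S.
by apply: simple_triangles_cut_ge3; apply: TTs.
Qed.

End CographicCircuits.

Theorem theorem4 (E : finType) (M : matroid E) (hM : cographic M) :
  tau M <= 2 * nu M.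
Proof.
have [G [f f_bij fP]] := hM; pose TT := simple_triangles f.
have TT3 T : T \in TT -> #|T| = 3 by rewrite inE => /and3P[_ /eqP].
have [F [P [hitF [trivP PP] leFP]]] :=
  cover_le_packing (rep f) TT3 setT (@simple_triangles_config _ _ f).
rewrite setTI in leFP.
(* The preimage under [rep] consists of whole parallel classes, so hitting [rep @: T] means hitting
   [T]. *)
have hitX : triangle_hitting_set M (rep f @^-1: F).
  apply/forallP=> T; apply/implyP=> /(simple_triangle_rep f_bij fP)/hitF[k kF /imsetP[x xT kx]].
  by apply/pred0Pn; exists x; rewrite /= xT andbT inE -kx.
have packP : triangle_packing M P.
  rewrite /triangle_packing trivP andbT; apply/forall_inP=> T /PP[_ T3 TTT].
  exact: (triangle_of_rep f_bij fP T3 TTT).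
apply: (@leq_trans (2 * #|P|)); last first.
  by rewrite leq_mul2l (leq_bigmax_cond (F := fun P : {set {set E}} => #|P|)).
apply: leq_trans leFP; rewrite /tau.
by case: arg_minnP => [|X _]; [exact: triangle_hitting_setT | apply].
Qed.
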